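(* Let $E$ be a Banach lattice and let $\rho\in E_+$. Let $A$ be a closed linear operator on $E$ and $\mu$ a scalar such that $\mu+A$ is invertible and $(\mu+A)^{-1}$ is dominated by some bounded linear operator $(\mu+A)^{(-1)}_+$ on $E$. If $(\lambda,\varphi)$ is an eigenpair of $A$ such that $\varphi\in E_\rho$, then $$|\varphi|\le |\mu+\lambda|\,\|\varphi\|_\rho\,(\mu+A)^{(-1)}_+\rho .$$ If $\mu+A$ has positive inverse, one may take $(\mu+A)^{(-1)}_+:=(\mu+A)^{-1}$.
   Context: $E$ is a real or complex Banach lattice with positive cone $E_+$. For $\rho\in E_+$, $E_\rho:=\{f\in E:\exists c\ge 0\text{ with }|f|\le c\rho\}$ with gauge norm $\|f\|_\rho:=\inf\{c\ge0:|f|\le c\rho\}$; the infimum is attained. An operator $T$ on $E$ dominates an operator $S$ on $E$ if $|Sf|\le T|f|$ for all $f\in E$. An eigenpair of $A$ is a pair $(\lambda,\varphi)$ with $\lambda$ a scalar, $0\neq\varphi\in D(A)$ and $A\varphi=\lambda\varphi$. Invertible means that $\mu+A:D(A)\to E$ is bijective (with bounded inverse). *)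

(* Defs.v *)
From HB Require Import structures.
From mathcomp Require Import all_boot all_order all_algebra.
From mathcomp Require Import complex.
From mathcomp Require Import all_classical all_reals all_analysis.
From mathcomp Require Import lra ring.

Set Implicit Arguments.
Unset Strict Implicit.
Unset Printing Implicit Defensive.

Import Order.TTheory GRing.Theory Num.Theory.
Import numFieldNormedType.Exports.

Local Open Scope classical_set_scope.
Local Open Scope ring_scope.

Reserved Notation "f '<=v' g" (at level 70, no associativity).

(* The order is a plain relation: Hierarchy Builder cannot join the classes   *)
(* of order.v with NormedModule, because Num.NumDomain, which inherits from   *)
(* both sides, is already declared. vmod f is the modulus |f|.                *)
HB.mixin Record hasOrderModulus (E : Type) := {
  vle : E -> E -> Prop;
  vmod : E -> E
}.

#[short(type="modulusBanachType")]
HB.structure Definition ModulusBanach (K : numFieldType) :=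
  {E of CompleteNormedModule K E & hasOrderModulus E}.

Notation "f '<=v' g" := (vle f g) : ring_scope.

Definition is_lub (K : numFieldType) (E : modulusBanachType K) (A : set E)
    (m : E) : Prop :=
  (forall x, A x -> x <=v m) /\ (forall u, (forall x, A x -> x <=v u) -> m <=v u).

HB.mixin Record isBanachLattice (R : realType) E of ModulusBanach R E := {
  vlexx : forall x : E, x <=v x;
  vle_anti : forall x y : E, x <=v y -> y <=v x -> x = y;
  vle_trans : forall y x z : E, x <=v y -> y <=v z -> x <=v z;
  vleD2r : forall z x y : E, x <=v y -> x + z <=v y + z;
  vscaler_ge0 : forall (c : R) (x : E), 0 <= c -> 0 <=v x -> 0 <=v c *: x;
  vjoin_ex : forall x y : E, exists m, is_lub [set x; y] m;
  vmod_lub : forall x : E, is_lub [set x; - x] (vmod x);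
  vmod_norm : forall x y : E, vmod x <=v vmod y -> `|x| <= `|y|
}.

#[short(type="banachLatticeType")]
HB.structure Definition BanachLattice (R : realType) :=
  {E of ModulusBanach R E & isBanachLattice R E}.

Arguments vle_trans {R s} [y x z].
Arguments vle_anti {R s} [x y].
Arguments vleD2r {R s} z [x y].
Arguments vscaler_ge0 {R s} [c x].
Arguments vmod_norm {R s} [x y].

Section BanachLatticeTheory.
Variables (R : realType) (E : banachLatticeType R).
Implicit Types (x y z u v w : E) (c : R).

Lemma vleD x y z w : x <=v y -> z <=v w -> x + z <=v y + w.
Proof.
move=> xy zw; apply: (vle_trans (vleD2r z xy)).
by rewrite ![y + _]addrC; exact: vleD2r.
Qed.

Lemma vsub_ge0 x y : 0 <=v y - x <-> x <=v y.
Proof.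
split=> [/(vleD2r x)|/(vleD2r (- x))]; rewrite ?subrr//.
by rewrite add0r subrK.
Qed.

Lemma vleZ c x y : 0 <= c -> x <=v y -> c *: x <=v c *: y.
Proof.
move=> c0 /vsub_ge0 xy; apply/vsub_ge0; rewrite -scalerBr.
exact: vscaler_ge0.
Qed.

Lemma vleN2 x y : x <=v y -> - y <=v - x.
Proof. by move=> /vsub_ge0 xy; apply/vsub_ge0; rewrite opprK addrC. Qed.

Lemma vleZ2 c x y : 0 < c -> c *: x <=v c *: y -> x <=v y.
Proof.
move=> c0 /(@vleZ c^-1) h; have := h (ltW _); rewrite invr_gt0 => /(_ c0).
by rewrite !scalerA mulVf ?gt_eqF// !scale1r.
Qed.

Lemma vleZl a b x : a <= b -> 0 <=v x -> a *: x <=v b *: x.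
Proof.
move=> ab x0; apply/vsub_ge0; rewrite -scalerBl; apply: vscaler_ge0 => //.
by rewrite subr_ge0.
Qed.

Lemma is_lub_uniq (A : set E) m n : is_lub A m -> is_lub A n -> m = n.
Proof. by move=> [ubm lm] [ubn ln]; apply: vle_anti; [exact: lm|exact: ln]. Qed.

Lemma vle_mod x : x <=v vmod x.
Proof. by apply: (vmod_lub x).1; left. Qed.

Lemma vleN_mod x : - x <=v vmod x.
Proof. by apply: (vmod_lub x).1; right. Qed.

Lemma vmod_le x u : x <=v u -> - x <=v u -> vmod x <=v u.
Proof. by move=> xu nxu; apply: (vmod_lub x).2 => _ [->|->]. Qed.

Lemma vge0_double x : 0 <=v x + x -> 0 <=v x.
Proof.
move=> h; apply: (@vleZ2 2) => //; rewrite scaler0.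
by rewrite scaler_nat mulr2n.
Qed.

Lemma vmod_ge0 x : 0 <=v vmod x.
Proof.
apply: vge0_double.
by have := vleD (vle_mod x) (vleN_mod x); rewrite subrr.
Qed.

Lemma vge0_mod x : 0 <=v x -> vmod x = x.
Proof.
move=> x0; apply: vle_anti; last exact: vle_mod.
apply: vmod_le; first exact: vlexx.
by apply: vle_trans (x0); have := vleN2 x0; rewrite oppr0.
Qed.

Lemma vmod_mod x : vmod (vmod x) = vmod x.
Proof. by apply: vge0_mod; exact: vmod_ge0. Qed.

Lemma norm_vmod x : `|vmod x| = `|x|.
Proof.
by apply/le_anti/andP; split; apply: vmod_norm; rewrite vmod_mod; exact: vlexx.
Qed.

Lemma norm_vle x w : x <=v w -> - x <=v w -> `|x| <= `|w|.
Proof.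
move=> xw nxw; apply: vmod_norm; apply: (vle_trans (vmod_le xw nxw)).
exact: vle_mod.
Qed.

Lemma norm_vle0 x w : 0 <=v x -> x <=v w -> `|x| <= `|w|.
Proof.
move=> x0 xw; apply: norm_vle => //; apply: vle_trans xw.
by apply: vle_trans (x0); have := vleN2 x0; rewrite oppr0.
Qed.

Lemma vcone_closed u :
  (forall e : R, 0 < e -> exists2 v, 0 <=v v & `|u - v| <= e) -> 0 <=v u.
Proof.
move=> hu; have [p [ubp lp]] := vjoin_ex (- u) 0.
have p0 : 0 <=v p by apply: ubp; right.
have pu : - u <=v p by apply: ubp; left.
suff: p = 0 by move=> p00; have := vleN2 pu; rewrite p00 opprK oppr0.
apply/eqP; rewrite -normr_le0; apply/ler_addgt0Pr => e e0; rewrite add0r.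
have [v v0 uve] := hu e e0; apply: le_trans uve.
rewrite -(norm_vmod (u - v)); apply: norm_vle0 => //; apply: lp => _ [->|->].
  apply: vle_trans (vleN_mod _); apply/vsub_ge0.
  by rewrite opprK opprB subrK.
exact: vmod_ge0.
Qed.

Lemma lub_seq (s : seq E) x : exists m, is_lub [set` x :: s] m.
Proof.
elim: s x => [|y s ih] x.
  exists x; split=> [z|u]; last by apply; rewrite /= inE.
  by rewrite /= inE => /eqP ->; exact: vlexx.
have [m [ubm lm]] := ih y; have [n [ubn ln]] := vjoin_ex x m.
exists n; split=> [z|u ubu].
  rewrite /= inE => /orP[/eqP->|]; first by apply: ubn; left.
  by move=> zs; apply: vle_trans (ubn _ (or_intror erefl)); exact: ubm.
apply: ln => _ [->|->]; first by apply: ubu; rewrite /= inE eqxx.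
by apply: lm => z zs; apply: ubu; rewrite /= inE zs orbT.
Qed.

Lemma ler_harmonic (k : R) : 0 < k ->
  exists N : nat, forall n : nat, (N <= n)%N -> n.+1%:R^-1 <= k.
Proof.
by move=> k0; have [N _ hN] := near_infty_natSinv_lt (PosNum k0); exists N => n /hN/ltW.
Qed.

Lemma is_lub_approx (A : set E) (e : E) : 0 <=v e ->
  (forall k : R, 0 < k -> exists s : E,
    (forall u, (forall v, A v -> v <=v u) -> s <=v u) /\
    (forall v, A v -> v <=v s + k *: e)) ->
  exists m, is_lub A m.
Proof.
move=> e0 h.
have /choice[s hs] : forall n : nat, exists s : E,
    (forall u, (forall v, A v -> v <=v u) -> s <=v u) /\
    (forall v, A v -> v <=v s + n.+1%:R^-1 *: e).
  by move=> n; apply: h; rewrite invr_gt0.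
have s_le n m : s n - s m <=v m.+1%:R^-1 *: e.
  have := (hs n).1 _ (hs m).2 => /(vleD2r (- s m)).
  by rewrite addrAC subrr add0r.
have ke0 (n : nat) : 0 <=v n.+1%:R^-1 *: e by apply: vscaler_ge0.
have dist n m : `|s n - s m| <= (n.+1%:R^-1 + m.+1%:R^-1) * `|e|.
  have := @norm_vle (s n - s m) ((n.+1%:R^-1 + m.+1%:R^-1) *: e).
  rewrite normrZ ger0_norm ?addr_ge0//; apply.
    rewrite scalerDl -[s n - s m]add0r; exact: vleD.
  by rewrite opprB scalerDl -[s m - s n]addr0; exact: vleD.
have small (k : R) : 0 < k -> exists N : nat, forall n : nat, (N <= n)%N ->
    n.+1%:R^-1 * `|e| <= k.
  move=> k0; have k1 : 0 < k / (`|e| + 1) by rewrite divr_gt0// ltr_wpDl.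
  have [N hN] := ler_harmonic k1; exists N => n /hN.
  rewrite ler_pdivlMr ?ltr_wpDl//; apply: le_trans.
  by rewrite ler_pM2l ?invr_gt0// lerDl.
have cs : cauchy (s @ \oo).
  apply/cauchyP => k k0; have k3 : 0 < k / 3 by rewrite divr_gt0.
  have [N hN] := small _ k3; exists (s N); exists N => // n /= Nn.
  rewrite -ball_normE /= (le_lt_trans (dist N n))// mulrDl.
  apply: (@le_lt_trans _ _ (k / 3 + k / 3)); first by rewrite lerD// hN.
  lra.
have /cvg_ex[m sm] : cvgn s by exact: cauchy_cvg.
exists m.
have near_m (k : R) : 0 < k -> exists n, `|m - s n| <= k /\ n.+1%:R^-1 * `|e| <= k.
  move=> k0; have [N hN] := small _ k0.
  have /cvgrPdist_le /(_ k k0)[M _ hM] := sm.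
  exists (maxn N M); split; first by apply: hM; rewrite /= leq_maxr.
  by apply: hN; rewrite leq_maxl.
split=> [v Av|u ubu]; apply/vsub_ge0/vcone_closed => k k0.
  have k2 : 0 < k / 2 by rewrite divr_gt0.
  have [n [mn nk]] := near_m _ k2.
  exists (s n + n.+1%:R^-1 *: e - v); first by apply/vsub_ge0; exact: (hs n).2.
  rewrite opprB addrA subrK opprD addrA.
  rewrite (le_trans (ler_normB _ _))// [leRHS](splitr k) lerD//.
  by rewrite normrZ ger0_norm.
have [n [mn nk]] := near_m _ k0.
exists (u - s n); first by apply/vsub_ge0; exact: (hs n).1.
by rewrite opprB addrC addrA subrK distrC.
Qed.

End BanachLatticeTheory.

(* E + iE; the pair (x, y) stands for x + iy. *)
Definition complexification (E : Type) : Type := (E * E)%type.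

Section Complexification.
Variables (R : realType) (E : banachLatticeType R).
Local Notation C := (complexification E).

HB.instance Definition _ := GRing.Zmodule.copy C (E * E)%type.

Definition cscale (c : R[i]) (z : C) : C :=
  (complex.Re c *: z.1 - complex.Im c *: z.2,
   complex.Re c *: z.2 + complex.Im c *: z.1).

Let cscaleA a b z : cscale a (cscale b z) = cscale (a * b) z.
Proof.
case: a b z => [a a'] [b b'] [x y]; rewrite /cscale /=; congr pair.
  rewrite !scalerBr !scalerDr !scalerBl !scalerDl !scalerA.
  by rewrite !opprD -!addrA; congr +%R; rewrite addrA addrC.
rewrite !scalerBr !scalerDr !scalerBl !scalerDl !scalerA.
by rewrite -!addrA; congr +%R; rewrite addrA addrC.
Qed.

Let cscale1 : left_id 1 cscale.
Proof.
by case=> x y; rewrite /cscale /= !scale1r !scale0r subr0 addr0.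
Qed.

Let cscaleDr : right_distributive cscale +%R.
Proof.
move=> c [x y] [x' y']; rewrite /cscale /= !scalerDr opprD.
by congr pair; rewrite addrACA.
Qed.

Let cscaleDl z : {morph cscale^~ z : a b / a + b}.
Proof.
case: z => x y [a a'] [b b']; rewrite /cscale /= !scalerDl opprD.
by congr pair; rewrite addrACA.
Qed.

HB.instance Definition _ := GRing.Zmodule_isLmodule.Build R[i] C
  cscaleA cscale1 cscaleDr cscaleDl.

(* The real part of e^{-it} z. *)
Definition cphase (z : C) (t : R) : E := cos t *: z.1 + sin t *: z.2.

(* |z| = sup_t Re (e^{-it} z); the supremum always exists: see cmod_lub. *)
Definition cmod (z : C) : E := xget 0 (is_lub [set cphase z t | t in [set: R]]).

(* w - z belongs to the cone of E. *)
Definition cvle (z w : C) : Prop := z.2 = w.2 /\ z.1 <=v w.1.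

Definition cvmod (z : C) : C := (cmod z, 0).

Let circ (z : C) : set E :=
  [set a.1 *: z.1 + a.2 *: z.2 | a in [set a : R * R | a.1 ^+ 2 + a.2 ^+ 2 = 1]].

Lemma cphaseE (z : C) : [set cphase z t | t in [set: R]] = circ z.
Proof.
apply/seteqP; split=> [_ [t _ <-]|_ [[a b] /= ab <-]].
  by exists (cos t, sin t) => //=; exact: cos2Dsin2.
have a1 : -1 <= a <= 1.
  by rewrite -ler_norml -(@ler_sqr _ `|a| 1) ?nnegrE// expr1n real_normK ?num_real// -ab lerDl sqr_ge0.
have b2 : Num.sqrt (1 - a ^+ 2) = `|b|.
  by rewrite -ab addrAC subrr add0r sqrtr_sqr.
have [b0|b0] := leP 0 b.
  exists (acos a) => //; rewrite /cphase acosK ?sin_acos//; last first.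
  by rewrite b2 ger0_norm.
exists (- acos a) => //; rewrite /cphase cosN sinN acosK ?sin_acos//.
by rewrite b2 ltr0_norm// opprK.
Qed.

Lemma circ_bound (z : C) (a : R * R) : a.1 ^+ 2 + a.2 ^+ 2 = 1 ->
  -1 <= a.1 <= 1 /\ -1 <= a.2 <= 1.
Proof.
move=> a1; have h (x y : R) : x ^+ 2 + y ^+ 2 = 1 -> -1 <= x <= 1.
  move=> xy.
  by rewrite -ler_norml -(@ler_sqr _ `|x| 1) ?nnegrE// expr1n real_normK ?num_real// -xy lerDl sqr_ge0.
by split; [exact: h a1|apply: (h _ a.1); rewrite addrC].
Qed.

Lemma vle_scale_mod (a k : R) (x : E) : `|a| <= k -> a *: x <=v k *: vmod x.
Proof.
move=> ak; have k0 : 0 <= k by apply: le_trans ak.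
apply: vle_trans (vleZl ak (vmod_ge0 x)).
have [a0|a0] := leP 0 a.
  by rewrite ger0_norm//; apply: vleZ => //; exact: vle_mod.
rewrite ltr0_norm// -[a *: x]opprK -scalerN -scaleNr; apply: vleZ.
  by rewrite oppr_ge0 ltW.
exact: vleN_mod.
Qed.

Lemma cmod_lub (z : C) : is_lub [set cphase z t | t in [set: R]] (cmod z).
Proof.
rewrite /cmod; set A := (X in is_lub X); case: xgetP => // H; exfalso.
suff [m Am] : exists m, is_lub A m by exact: (H m).
pose e : E := vmod z.1 + vmod z.2.
have e0 : 0 <=v e by rewrite -[0]addr0; apply: vleD; exact: vmod_ge0.
apply: (is_lub_approx e0) => k k0.
have [N hN] := ler_harmonic k0.
pose M : R := N.+1%:R; have M0 : 0 < M by [].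
pose cell (a : R * R) := (Num.truncn ((a.1 + 1) * M), Num.truncn ((a.2 + 1) * M)).
pose S := [set a : R * R | a.1 ^+ 2 + a.2 ^+ 2 = 1].
have S10 : S (1, 0) by rewrite /S /= expr1n expr0n addr0.
pose pt (ij : nat * nat) : R * R := xget (1, 0) [set a | S a /\ cell a = ij].
have ptS ij : S (pt ij) by rewrite /pt; case: xgetP => [? _ []|_].
have ptcell a : S a -> cell (pt (cell a)) = cell a.
  move=> Sa; rewrite /pt; case: xgetP => [? _ []//|/(_ a)[]]//.
pose val (a : R * R) : E := a.1 *: z.1 + a.2 *: z.2.
pose B := (2 * N.+1).+1.
pose s : seq E := [seq val (pt (i, j)) | i <- iota 0 B, j <- iota 0 B].
have [m [ubm lm]] := lub_seq s (val (1, 0)).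
rewrite /A cphaseE; exists m; split=> [u ubu|v [a Sa <-]].
  apply: lm => x /=; rewrite inE => /orP[/eqP ->|].
    by apply: ubu; exists (1, 0).
  move=> /allpairsP[[i j] [_ _ ->]]; apply: ubu.
  by exists (pt (i, j)) => //; exact: ptS.
have trunc_lt (x : R) : -1 <= x <= 1 -> (Num.truncn ((x + 1) * M) < B)%N.
  move=> /andP[x1 x2]; have x0 : 0 <= (x + 1) * M.
    by apply: mulr_ge0; [lra|exact: ltW].
  rewrite ltnS truncn_le_nat (@le_lt_trans _ _ (2 * M))//.
    by rewrite ler_pM2r//; lra.
  by rewrite -natrM ltr_nat.
have near (x y : R) : -1 <= x <= 1 -> -1 <= y <= 1 ->
   Num.truncn ((x + 1) * M) = Num.truncn ((y + 1) * M) -> `|x - y| <= k.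
  move=> x1 y1 xy; apply: le_trans (hN _ (leqnn _)).
  have := @truncn_itv _ ((x + 1) * M) _; have := @truncn_itv _ ((y + 1) * M) _.
  have p (w : R) : -1 <= w <= 1 -> 0 <= (w + 1) * M.
    by move=> w1; apply: mulr_ge0; [lra|exact: ltW].
  move=> /(_ (p _ y1)) + /(_ (p _ x1)); rewrite xy -[_.+1%:R]natr1.
  set q := _%:R => yq xq.
  rewrite -[_^-1]mul1r ler_pdivlMr// -/M -[M in `|_| * M](gtr0_norm M0) -normrM.
  by rewrite ler_norml mulrBl; lra.
have [ca1 ca2] := circ_bound z Sa.
have [cb1 cb2] := circ_bound z (ptS (cell a)).
set b := pt (cell a) in cb1 cb2.
have vb : val b <=v m.
  apply: ubm; rewrite /= inE; apply/orP; right.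
  apply/allpairsP; exists (cell a); split=> //; rewrite mem_iota add0n; exact: trunc_lt.
have [e1 e2] : cell b = cell a := ptcell a Sa.
apply: (@vle_trans _ _ (val b + ((a.1 - b.1) *: z.1 + (a.2 - b.2) *: z.2))).
  rewrite /val addrACA -!scalerDl ![b.1 + _]addrC ![b.2 + _]addrC !subrK.
  exact: vlexx.
apply: vleD => //; rewrite /e scalerDr.
by apply: vleD; apply: vle_scale_mod; exact: near.
Qed.

Lemma cmod_le (z : C) (a b r : R) : 0 <= r -> a ^+ 2 + b ^+ 2 = r ^+ 2 ->
  a *: z.1 + b *: z.2 <=v r *: cmod z.
Proof.
move=> r0; case: (eqVneq r 0) => [->|rn0] abr.
  move/eqP: abr; rewrite expr0n paddr_eq0 ?sqr_ge0// !sqrf_eq0.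
  by move=> /andP[/eqP-> /eqP->]; rewrite !scale0r addr0; exact: vlexx.
have [ub _] := cmod_lub z; rewrite cphaseE in ub.
have {ub} := ub (a / r *: z.1 + b / r *: z.2).
have S : (a / r) ^+ 2 + (b / r) ^+ 2 = 1.
  by rewrite !exprMn -mulrDl abr -exprMn divff// expr1n.
move=> /(_ (ex_intro2 _ _ (a / r, b / r) S erefl)) /(vleZ r0).
by rewrite scalerDr !scalerA ![r * (_ / _)]mulrC !divfK.
Qed.

Lemma cmod_least (z : C) (u : E) :
  (forall a b : R, a ^+ 2 + b ^+ 2 = 1 -> a *: z.1 + b *: z.2 <=v u) ->
  cmod z <=v u.
Proof.
move=> h; have [_ lub] := cmod_lub z; rewrite cphaseE in lub.
by apply: lub => _ [[a b] /= ab <-]; exact: h.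
Qed.

Lemma vmod1_cmod (z : C) : vmod z.1 <=v cmod z.
Proof.
have h (a : R) : a ^+ 2 = 1 -> a *: z.1 <=v cmod z.
  move=> a1; have := @cmod_le z a 0 1 ler01.
  by rewrite a1 !expr2 mulr0 mulr1 addr0 scale0r addr0 scale1r; exact.
apply: vmod_le; first by rewrite -[z.1]scale1r; apply: h; rewrite expr1n.
by rewrite -scaleN1r; apply: h; rewrite sqrrN expr1n.
Qed.

Lemma vmod2_cmod (z : C) : vmod z.2 <=v cmod z.
Proof.
have h (a : R) : a ^+ 2 = 1 -> a *: z.2 <=v cmod z.
  move=> a1; have := @cmod_le z 0 a 1 ler01.
  by rewrite a1 !expr2 mulr0 mulr1 add0r scale0r add0r scale1r; exact.
apply: vmod_le; first by rewrite -[z.2]scale1r; apply: h; rewrite expr1n.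
by rewrite -scaleN1r; apply: h; rewrite sqrrN expr1n.
Qed.

Lemma cmod_ge0 (z : C) : 0 <=v cmod z.
Proof. exact: vle_trans (vmod_ge0 _) (vmod1_cmod z). Qed.

Lemma cmod_le_add (z : C) : cmod z <=v vmod z.1 + vmod z.2.
Proof.
apply: cmod_least => a b ab.
have [a1 b1] := @circ_bound z (a, b) ab.
rewrite -[X in _ <=v X + _]scale1r -[X in _ <=v _ + X]scale1r.
by apply: vleD; apply: vle_scale_mod; rewrite ler_norml.
Qed.

Lemma cmodD (z w : C) : cmod (z + w) <=v cmod z + cmod w.
Proof.
apply: cmod_least => a b ab; rewrite !scalerDr addrACA.
by apply: vleD; rewrite -[X in _ <=v X]scale1r; apply: cmod_le;
  rewrite ?expr1n.
Qed.

Lemma cmod0 : cmod 0 = 0.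
Proof.
apply: vle_anti; last exact: cmod_ge0.
apply: cmod_least => a b _; rewrite !scaler0 addr0; exact: vlexx.
Qed.

Let cmodZ_le (c : R[i]) (z : C) : cmod (c *: z) <=v complex.Re `|c| *: cmod z.
Proof.
apply: cmod_least => a b ab; case: c => p q.
have -> : a *: ((p +i* q)%C *: z).1 + b *: ((p +i* q)%C *: z).2 =
    (a * p + b * q) *: z.1 + (b * p - a * q) *: z.2.
  rewrite /= !scalerDr !scalerN !scalerA scalerDl scalerBl.
  by rewrite -!addrA; congr +%R; rewrite addrA [RHS]addrC; congr +%R; rewrite addrC.
apply: cmod_le; first by rewrite normc_def /= sqrtr_ge0.
rewrite normc_def /= sqr_sqrtr ?addr_ge0 ?sqr_ge0//.
by rewrite -[RHS]mul1r -ab; ring.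
Qed.

Lemma cmodZ (c : R[i]) (z : C) : cmod (c *: z) = complex.Re `|c| *: cmod z.
Proof.
apply: vle_anti; first exact: cmodZ_le.
have [->|c0] := eqVneq c 0; first by rewrite normr0 scale0r; exact: cmod_ge0.
have := cmodZ_le c^-1 (c *: z); rewrite scalerA mulVf// scale1r.
have r0 : 0 <= complex.Re `|c| by rewrite normc_def /= sqrtr_ge0.
move=> /(vleZ r0); rewrite scalerA.
suff -> : complex.Re `|c| * complex.Re `|c^-1| = 1 by rewrite scale1r.
have : `|c| * `|c^-1| = 1 by rewrite -normrM mulfV// normr1.
by rewrite !normc_def /= -rmorphM => /(congr1 (@complex.Re R)).
Qed.

(* The norm of a complex Banach lattice is || |z| ||, as a scalar of R[i]. *)
Definition cnorm (z : C) : R[i] := (`|cmod z|)%:C%C.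

Let ler_cnormD (z w : C) : cnorm (z + w) <= cnorm z + cnorm w.
Proof.
rewrite /cnorm -rmorphD lecR; apply: le_trans (ler_normD _ _).
by apply: norm_vle0; [exact: cmod_ge0|exact: cmodD].
Qed.

Let cnormZ (c : R[i]) (z : C) : cnorm (c *: z) = `|c| * cnorm z.
Proof.
by rewrite /cnorm cmodZ normrZ rmorphM normc_def /= ger0_norm// sqrtr_ge0.
Qed.

Let cnorm0_eq0 (z : C) : cnorm z = 0 -> z = 0.
Proof.
move=> [] /normr0_eq0 z0.
have := vmod1_cmod z; have := vmod2_cmod z; rewrite z0.
have h (x : E) : vmod x <=v 0 -> x = 0.
  move=> x0; apply/eqP; rewrite -normr_eq0 -norm_vmod.
  by rewrite (vle_anti x0 (vmod_ge0 x)) normr0.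
by case: z {z0} => x y /= /h -> /h ->.
Qed.

HB.instance Definition _ := Lmodule_isNormed.Build R[i] C
  ler_cnormD cnormZ cnorm0_eq0.

Lemma cnormE (z : C) : `|z| = (`|cmod z|)%:C%C.
Proof. by []. Qed.

Lemma ler_norm1_cmod (z : C) : `|z.1| <= `|cmod z|.
Proof.
rewrite -norm_vmod; apply: norm_vle0; [exact: vmod_ge0|exact: vmod1_cmod].
Qed.

Lemma ler_norm2_cmod (z : C) : `|z.2| <= `|cmod z|.
Proof.
rewrite -norm_vmod; apply: norm_vle0; [exact: vmod_ge0|exact: vmod2_cmod].
Qed.

Lemma ler_cmod_norm (z : C) : `|cmod z| <= `|z.1| + `|z.2|.
Proof.
rewrite -(norm_vmod z.1) -(norm_vmod z.2); apply: le_trans (ler_normD _ _).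
by apply: norm_vle0; [exact: cmod_ge0|exact: cmod_le_add].
Qed.

Let ccomplete (F : set_system C) : ProperFilter F -> cauchy F -> cvg F.
Proof.
move=> FF /cauchyP cF.
have c1 : cauchy ((fst : C -> E) @ F).
  apply/cauchyP => e e0; have [|z Fz] := cF e%:C%C; first by rewrite ltcR.
  exists z.1; suff : F [set w : C | ball z.1 e w.1] by [].
  apply: filterS Fz => w; rewrite -!ball_normE /ball_ /mkset cnormE ltcR.
  by apply: le_lt_trans; exact: (ler_norm1_cmod (z - w)).
have c2 : cauchy ((snd : C -> E) @ F).
  apply/cauchyP => e e0; have [|z Fz] := cF e%:C%C; first by rewrite ltcR.
  exists z.2; suff : F [set w : C | ball z.2 e w.2] by [].
  apply: filterS Fz => w; rewrite -!ball_normE /ball_ /mkset cnormE ltcR.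
  by apply: le_lt_trans; exact: (ler_norm2_cmod (z - w)).
have /cvg_ex[x Fx] : cvg ((fst : C -> E) @ F) by exact: cauchy_cvg.
have /cvg_ex[y Fy] : cvg ((snd : C -> E) @ F) by exact: cauchy_cvg.
apply/cvg_ex; exists ((x, y) : C); apply/fcvgrPdist_lt => e e0.
have [er e0' ->] : exists2 er : R, 0 < er & e = er%:C%C.
  by case: e e0 => a b; rewrite ltcE /= => /andP[/eqP -> a0]; exists a.
have e2 : 0 < er / 2 by rewrite divr_gt0.
have /cvgrPdist_lt /(_ _ e2) h1 := Fx.
have /cvgrPdist_lt /(_ _ e2) h2 := Fy.
near=> w; rewrite cnormE ltcR.
apply: (le_lt_trans (ler_cmod_norm _)); rewrite [ltRHS]splitr.
by apply: ltrD; near: w.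
Unshelve. all: by end_near. Qed.

HB.instance Definition _ := Uniform_isComplete.Build C ccomplete.

HB.instance Definition _ := hasOrderModulus.Build C cvle cvmod.

End Complexification.

(* "E is a real or complex Banach lattice". *)
Inductive banach_lattice (R : realType) :
    forall K : numFieldType, modulusBanachType K -> Prop :=
| real_banach_lattice (E : banachLatticeType R) :
    @banach_lattice R R E
| complex_banach_lattice (E : banachLatticeType R) :
    @banach_lattice R R[i] (complexification E).

Section Ideal.
Variables (K : numFieldType) (E : modulusBanachType K).

Definition in_ideal (rho f : E) : Prop :=
  exists2 c : K, 0 <= c & vmod f <=v c *: rho.

(* Over R[i] the infimum is taken for the usual partial order, in which       *)
(* 0 <= c forces c to be real, so that it is the infimum of a set of reals.   *)
Definition gauge_norm (rho f : E) : K :=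
  infimum 0 [set c : K | 0 <= c /\ vmod f <=v c *: rho].

End Ideal.

Section Operators.
Variables (K : numFieldType) (E : modulusBanachType K).

(* A linear operator with domain dom; its values off dom are irrelevant.      *)
Record operator := Operator {
  dom : set E;
  opfun :> E -> E;
  dom0 : dom 0;
  dom_linear : forall (a : K) (f g : E), dom f -> dom g -> dom (a *: f + g);
  opfun_linear : forall (a : K) (f g : E), dom f -> dom g ->
    opfun (a *: f + g) = a *: opfun f + opfun g
}.

Definition closed_operator (A : operator) : Prop :=
  closed [set p : E * E | dom A p.1 /\ p.2 = A p.1].

Let add_scalar_linear (mu : K) (A : operator) (a : K) (f g : E) :
  dom A f -> dom A g ->
  mu *: (a *: f + g) + A (a *: f + g) =
  a *: (mu *: f + A f) + (mu *: g + A g).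
Proof.
move=> Af Ag; rewrite opfun_linear// !scalerDr !scalerA mulrC.
by rewrite addrACA.
Qed.

Definition add_scalar (mu : K) (A : operator) : operator :=
  Operator (dom0 A) (@dom_linear A) (@add_scalar_linear mu A).

(* Meaningful when B is a bijection from dom B onto E: then op_inv B maps E   *)
(* into dom B and inverts B there.                                            *)
Definition op_inv (B : operator) : E -> E := 'pinv_(fun=> 0) (dom B) B.

Definition bounded_operator (T : E -> E) : Prop :=
  exists M : K, forall f : E, `|T f| <= M * `|f|.

Definition bounded_linear (T : E -> E) : Prop := linear T /\ bounded_operator T.

Definition invertible (B : operator) : Prop :=
  set_bij (dom B) [set: E] B /\ bounded_operator (op_inv B).

Definition dominates (T S : E -> E) : Prop :=
  forall f : E, vmod (S f) <=v T (vmod f).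

Definition positive_operator (T : E -> E) : Prop :=
  forall f : E, 0 <=v f -> 0 <=v T f.

Definition eigenpair (A : operator) (lambda : K) (phi : E) : Prop :=
  [/\ phi != 0, dom A phi & A phi = lambda *: phi].

End Operators.

(* Main.v *)
(* The eigenvalue equation gives phi = (mu + A)^-1 ((mu + lambda) phi), so by
   domination |phi| <= |mu + lambda| T |phi|. As T is positive and the infimum
   defining the gauge norm is attained, T |phi| <= ||phi||_rho T rho. *)
Require Import Defs.
From HB Require Import structures.
From mathcomp Require Import all_boot all_order all_algebra.
From mathcomp Require Import complex.
From mathcomp Require Import all_classical all_reals all_analysis.
Import Order.TTheory GRing.Theory Num.Theory.
Import numFieldNormedType.Exports.
Local Open Scope classical_set_scope.
Local Open Scope ring_scope.

(** Reduces the computation of [gauge_norm] to exhibiting a least dominating scalar: in a partial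
    order [infimum] is chosen among the greatest lower bounds, of which there is at most one. Since
    [S] contains [m], the default [x0] for the empty set never occurs. *)
Lemma infimum_min {d} {T : porderType d} (x0 m : T) (S : set T) :
  S m -> lbound S m -> infimum x0 S = m.
Proof.
move=> Sm lbm; rewrite /infimum; case: ifPn => [/eqP S0|_].
  by move: Sm; rewrite S0.
have infm : infimums S m by split=> // x; exact.
by case: xgetP => [x _ infx|/(_ m)//]; exact: (is_subset1_infimums infx infm).
Qed.

Lemma vmodZ {R : realType} {E : banachLatticeType R} (c : R) (x : E) :
  vmod (c *: x) = `|c| *: vmod x.
Proof.
have le (a : R) (y : E) : vmod (a *: y) <=v `|a| *: vmod y.
  by apply: vmod_le; rewrite -?scaleNr; apply: vle_scale_mod; rewrite ?normrN.
apply: vle_anti; first exact: le.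
have [->|c0] := eqVneq c 0; first by rewrite normr0 !scale0r; exact: vmod_ge0.
(* The reverse inequality is [le] for the scalar [c^-1] and the vector [c *: x], multiplied by
   [|c|]. *)
have /(vleZ (normr_ge0 c)) := le c^-1 (c *: x).
by rewrite !scalerA mulVf// scale1r normfV mulfV ?normr_eq0// scale1r.
Qed.

(** The infimum is attained because the positive cone is closed: [inf S *: rho - u] is a norm limit
    of positive elements [c *: rho - u] with [c] in [S]. *)
Lemma min_dominating_scalar {R : realType} {E : banachLatticeType R} (u rho : E)
    (c0 : R) : 0 <= c0 -> u <=v c0 *: rho ->
  exists m : R, [/\ 0 <= m, u <=v m *: rho &
    forall c, 0 <= c -> u <=v c *: rho -> m <= c].
Proof.
move=> c0_ge0 uc0; pose S := [set c : R | 0 <= c /\ u <=v c *: rho].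
have S0 : lbound S 0 by move=> c [].
have Sne : S !=set0 by exists c0.
have Slb : has_lbound S by exists 0.
exists (inf S); split=> [||c c_ge0 uc]; first exact: lb_le_inf.
- apply/vsub_ge0/vcone_closed => e e_gt0.
  (* Adding 1 keeps the denominator positive when [rho = 0]. *)
  have k_gt0 : 0 < e / (`|rho| + 1) by rewrite divr_gt0// ltr_wpDl.
  have [c Sc cm] := inf_adherent k_gt0 (conj Sne Slb).
  exists (c *: rho - u); first by apply/vsub_ge0; case: Sc.
  rewrite opprB addrA subrK -scalerBl normrZ distrC ger0_norm; last first.
    by rewrite subr_ge0; exact: ge_inf.
  apply: (@le_trans _ _ (e / (`|rho| + 1) * `|rho|)).
    by rewrite ler_wpM2r// lerBlDl ltW.
  by rewrite -mulrAC ler_pdivrMr ?ltr_wpDl// ler_pM2l// lerDl.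
- exact: ge_inf.
Qed.

Section RealOrComplexBanachLattice.
Context {R : realType} {K : numFieldType} {E : modulusBanachType K}.
Hypothesis E_bl : banach_lattice R E.

Lemma bl_vle_trans (y x z : E) : x <=v y -> y <=v z -> x <=v z.
Proof.
case: K E / E_bl x y z => E' x y z; first exact: vle_trans.
by move=> [xy2 xy1] [yz2 yz1]; split; [rewrite xy2|exact: vle_trans xy1 yz1].
Qed.

Lemma bl_vsub_ge0 (x y : E) : 0 <=v y - x <-> x <=v y.
Proof.
case: K E / E_bl x y => E' x y; first exact: vsub_ge0.
split=> -[/= h2 h1]; last by split; [rewrite /= h2 subrr|exact/vsub_ge0].
by split; [apply/esym/eqP; rewrite -subr_eq0 -h2|exact/vsub_ge0].
Qed.

Lemma bl_vmod_ge0 (x : E) : 0 <=v vmod x.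
Proof.
case: K E / E_bl x => E' x; first exact: vmod_ge0.
by split=> //; exact: cmod_ge0.
Qed.

Lemma bl_vge0_mod (x : E) : 0 <=v x -> vmod x = x.
Proof.
case: K E / E_bl x => E' x; first exact: vge0_mod.
move=> [/= x2 x1]; rewrite [LHS]/(cvmod x) /cvmod [RHS]surjective_pairing -x2.
congr pair; apply: vle_anti; last exact: vle_trans (vle_mod _) (vmod1_cmod x).
(* As the imaginary part vanishes, the bound [|x.1| + |x.2|] collapses to [x.1]. *)
apply: vle_trans (cmod_le_add x) _.
by rewrite -x2 (vge0_mod x1) (vge0_mod (vlexx _)) addr0; exact: vlexx.
Qed.

Lemma bl_vscaler_ge0 (c : K) (x : E) : 0 <= c -> 0 <=v x -> 0 <=v c *: x.
Proof.
case: K E / E_bl c x => E' c x; first exact: vscaler_ge0.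
(* In [R[i]], [0 <= c] forces the imaginary part of [c] to be 0. *)
case: c => a b; rewrite lecE /= => /andP[/eqP-> a0] [/= x2 x1].
split; rewrite /= -x2 scale0r ?scaler0 ?addr0// subr0.
exact: vscaler_ge0.
Qed.

Lemma bl_vmodZ (c : K) (x : E) : vmod (c *: x) = `|c| *: vmod x.
Proof.
case: K E / E_bl c x => E' c x; first exact: vmodZ.
change (cvmod (c *: x) = Defs.cscale `|c| (cvmod x)).
rewrite /cvmod cmodZ normc_def /Defs.cscale /=.
by rewrite !scale0r subr0 scaler0 add0r; congr pair.
Qed.

(** Attainment of the gauge norm. The complex case reduces to the real one: the admissible scalars
    and [rho] are real, so only [cmod f] and [rho.1] are compared. *)
Lemma bl_gauge_norm (rho f : E) : 0 <=v rho -> in_ideal rho f ->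
  vmod f <=v gauge_norm rho f *: rho.
Proof.
move=> rho0 f_rho.
suff [m [m0 fm minm]] : exists m : K, [/\ 0 <= m, vmod f <=v m *: rho &
    forall c, 0 <= c -> vmod f <=v c *: rho -> m <= c].
  by rewrite /gauge_norm (infimum_min _ m)// => c []; exact: minm.
case: K E / E_bl rho f rho0 f_rho => E' rho f rho0 [c0 c0_ge0 fc0].
  exact: min_dominating_scalar c0_ge0 fc0.
have rho2 : rho.2 = 0 by case: rho0.
have le_realE (a : R) :
    vmod f <=v (a%:C%C : R[i]) *: rho <-> cmod f <=v a *: rho.1.
  split=> [[_]|h]; first by rewrite /= rho2 scaler0 subr0.
  by split; rewrite /= rho2 !scaler0 ?subr0 // scale0r addr0.
have realE (c : R[i]) : 0 <= c -> c = (complex.Re c)%:C%C.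
  by case: c => a b; rewrite lecE /= => /andP[/eqP ->].
move: fc0; rewrite (realE _ c0_ge0) => /le_realE fc0.
have [|m [m0 fm minm]] := min_dominating_scalar _ _ _ _ fc0.
  by move: c0_ge0; rewrite lecE => /andP[].
exists m%:C%C; split; [by rewrite lecR|exact/le_realE|].
move=> c c_ge0; rewrite (realE _ c_ge0) => /le_realE fc; rewrite lecR.
by apply: minm fc; move: c_ge0; rewrite lecE => /andP[].
Qed.

(** If [0 <=v f] then [f] is its own modulus, so [T f] lies above [vmod (S f)]. *)
Lemma dominates_positive (T S : E -> E) :
  dominates T S -> positive_operator T.
Proof.
move=> TS f f0; rewrite -(bl_vge0_mod _ f0).
exact: bl_vle_trans (bl_vmod_ge0 _) (TS f).
Qed.

Lemma positive_monotone (T : E -> E) (f g : E) : linear T ->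
  positive_operator T -> f <=v g -> T f <=v T g.
Proof.
move=> Tlin Tpos /bl_vsub_ge0 /Tpos.
by rewrite (GRing.zmod_morphism_linear Tlin) => /bl_vsub_ge0.
Qed.

(* In the complex case, [S] maps real elements to real ones, so that
   [Re (e^{-it} S z) = S (Re (e^{-it} z)) <= S |z|] for every [t]. *)
Lemma positive_dominates (S : E -> E) : linear S ->
  positive_operator S -> dominates S S.
Proof.
move=> Slin Spos; have SZ := GRing.scalable_linear Slin.
have SB := GRing.zmod_morphism_linear Slin.
have mono f g := @positive_monotone S f g Slin Spos.
have S0 : S 0 = 0 by rewrite -[0 in LHS](subrr 0) SB subrr.
case: K E / E_bl S Slin Spos SZ SB mono S0 => E' S _ _ SZ SB mono S0 f.
  apply: vmod_le; first exact/mono/vle_mod.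
  by rewrite -[- S f]sub0r -S0 -SB sub0r; exact/mono/vleN_mod.
pose re (x : E') : complexification E' := (x, 0).
have mono_re (x y : E') : x <=v y -> S (re x) <=v S (re y).
  by move=> xy; apply: mono; split.
(* Comparable elements have equal imaginary parts; the images of [x], its modulus and 0 are linked
   by [x <=v vmod x] and [0 <=v vmod x], and [S 0 = 0]. *)
have real (x : E') : (S (re x)).2 = 0.
  have [-> _] := mono_re _ _ (vle_mod x).
  have [<- _] := mono_re _ _ (vmod_ge0 x).
  by rewrite (_ : re 0 = 0) ?S0.
split; first by rewrite [RHS]real.
apply: cmod_least => a b ab.
have -> : a *: (S f).1 + b *: (S f).2 = (S (re (a *: f.1 + b *: f.2))).1.
  (* Writing [f = f.1 + i f.2], the rotation [(a - ib) f] has real part [a f.1 + b f.2] and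
     imaginary part [a f.2 - b f.1]. Subtracting [i] times the latter isolates the real part; after
     applying [S] that term is [i] times a real element and does not affect the first component. *)
  have rot : re (a *: f.1 + b *: f.2) =
      ((a -i* b)%C : R[i]) *: f - ('i%C : R[i]) *: re (a *: f.2 - b *: f.1).
    congr pair; rewrite /= !(scale0r, scaler0, scale1r, scaleNr, addr0, add0r).
      by rewrite !opprK addr0.
    by rewrite subrr.
  rewrite rot SB !SZ /= real.
  by rewrite !(scaleNr, oppr0, scale0r, scaler0, opprK, addr0, subr0).
suff /mono_re[_ +] : a *: f.1 + b *: f.2 <=v cmod f by [].
by rewrite -[cmod f]scale1r; apply: cmod_le; rewrite ?expr1n.
Qed.

End RealOrComplexBanachLattice.

Section Inverse.
Context {K : numFieldType} {E : modulusBanachType K} {B : operator E}.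
Hypothesis B_bij : set_bij (dom B) [set: E] B.

Lemma dom_op_inv (g : E) : dom B (op_inv B g).
Proof. by have [+ _ _] := bijpinv_bij (fun=> 0) B_bij; exact. Qed.

Lemma opfunK (f : E) : dom B f -> op_inv B (B f) = f.
Proof.
by move=> Bf; apply: pinvKV; [exact: set_bij_inj B_bij|rewrite inE].
Qed.

Lemma op_invK (g : E) : B (op_inv B g) = g.
Proof. by apply: (surjpK _ (set_bij_surj B_bij)); rewrite inE. Qed.

Lemma op_inv_linear : linear (op_inv B).
Proof.
move=> a f g; have [Bf Bg] := (dom_op_inv f, dom_op_inv g).
(* Writing [f] and [g] as images under [B] transfers the linearity of [B] to its inverse. *)
rewrite -[in LHS](op_invK f) -[in LHS](op_invK g) -opfun_linear//.
by rewrite opfunK//; exact: dom_linear.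
Qed.

End Inverse.

(** Serves both halves of the theorem: [T] may be a given dominating operator or the inverse
    itself. *)
Lemma eigenvector_bound {R : realType} {K : numFieldType}
    {E : modulusBanachType K} (E_bl : banach_lattice R E) (rho : E)
    (A : operator E) (mu : K) (T : E -> E) (lambda : K) (phi : E) :
  0 <=v rho -> set_bij (dom (add_scalar mu A)) [set: E] (add_scalar mu A) ->
  linear T -> dominates T (op_inv (add_scalar mu A)) ->
  eigenpair A lambda phi -> in_ideal rho phi ->
  vmod phi <=v (`|mu + lambda| * gauge_norm rho phi) *: T rho.
Proof.
move=> rho0 Bbij Tlin TS [_ Aphi eig] phi_rho.
have phiE : op_inv (add_scalar mu A) ((mu + lambda) *: phi) = phi.
  by rewrite scalerDl -eig; exact: opfunK Bbij _ Aphi.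
have phi_le := bl_gauge_norm E_bl _ _ rho0 phi_rho.
have := TS ((mu + lambda) *: phi); rewrite phiE (bl_vmodZ E_bl).
(* The scalar moves inside [T], so that monotonicity leaves only an inequality between the arguments
   of [T]. *)
move=> /(bl_vle_trans E_bl); apply; rewrite -(GRing.scalable_linear Tlin).
apply: (positive_monotone E_bl) => //; first exact: dominates_positive E_bl _ _ TS.
rewrite -scalerA; apply/(bl_vsub_ge0 E_bl); rewrite -scalerBr.
by apply: (bl_vscaler_ge0 E_bl) => //; apply/(bl_vsub_ge0 E_bl).
Qed.

Theorem theorem3p1 (R : realType) (K : numFieldType) (E : modulusBanachType K)
    (E_bl : banach_lattice R E) (rho : E) (rho_ge0 : 0 <=v rho)
    (A : operator E) (A_closed : closed_operator A) (mu : K)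
    (muA_inv : invertible (add_scalar mu A)) :
  (forall T : E -> E, bounded_linear T ->
     dominates T (op_inv (add_scalar mu A)) ->
     forall (lambda : K) (phi : E), eigenpair A lambda phi -> in_ideal rho phi ->
     vmod phi <=v (`|mu + lambda| * gauge_norm rho phi) *: T rho) /\
  (positive_operator (op_inv (add_scalar mu A)) ->
     [/\ bounded_linear (op_inv (add_scalar mu A)),
         dominates (op_inv (add_scalar mu A)) (op_inv (add_scalar mu A)) &
         forall (lambda : K) (phi : E), eigenpair A lambda phi -> in_ideal rho phi ->
         vmod phi <=v (`|mu + lambda| * gauge_norm rho phi)
                      *: op_inv (add_scalar mu A) rho]).
Proof.
have [Bbij Bbnd] := muA_inv; split=> [T [Tlin _] TS lambda phi|Bpos].
  exact: (eigenvector_bound E_bl).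
(* A positive inverse dominates itself, hence is an admissible [T]; its boundedness is part of
   invertibility. *)
have Blin := op_inv_linear Bbij; have BB := positive_dominates E_bl _ Blin Bpos.
by split=> // lambda phi; exact: (eigenvector_bound E_bl).
Qed.
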